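(* Let $M=[A,B]$ be an invertible $n\times n$ double-complex matrix, where $A,B$ are $n \times n$ complex matrices. Then $M$ has a Jordan SVD $M = U[J,J]V^*$ in which all the eigenvalues of $J$ belong to the half-plane $H$. Moreover, this is unique in the following sense: if $M = U[J,J]V^*$ and $M = U'[J',J'](V')^*$ are two Jordan SVDs of $M$ such that all the eigenvalues of $J$ and of $J'$ belong to $H$, then $J$ and $J'$ are equal up to a permutation of their Jordan blocks.
   Context: A double-complex number is a number of the form $w + zj$ with $w,z\in\mathbb{C}$, where $j^2=+1$ and multiplication is the commutative one $(w+zj)(w'+z'j) = ww'+zz' + j(wz'+zw')$. Conjugation is $(w+zj)^* = w - zj$ (with no complex conjugation of $w$ and $z$). A double-complex matrix is a matrix with double-complex entries; $M^*$ denotes its conjugate-transpose with respect to this conjugation. For $n\times n$ complex matrices $A,B$ define $[A,B] = A\frac{1+j}{2} + B^T\frac{1-j}{2}$ (with the plain transpose of $B$); every $n\times n$ double-complex matrix can be uniquely written in this form. One has $[A,B]+[C,D]=[A+C,B+D]$, $[A,B][C,D]=[AC,DB]$ and $[A,B]^*=[B,A]$. A square double-complex matrix $U$ is unitary if $U^*U = I$; equivalently $U=[P,P^{-1}]$ for some invertible complex matrix $P$. A complex Jordan matrix is a block diagonal matrix whose diagonal blocks are Jordan blocks $J_k(\lambda)$ ($k\ge 1$, $\lambda\in\mathbb{C}$), where $J_k(\lambda)$ is the $k \times k$ matrix with $\lambda$ on the diagonal, $1$ on the superdiagonal and $0$ elsewhere. A Jordan SVD of a double-complex matrix $M$ is a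 factorisation $M = U[J,J]V^*$ where $J$ is a complex Jordan matrix and $U$ and $V$ are unitary double-complex matrices. The half-plane is $H = \{z\in\mathbb{C} : \Re(z)>0\}\cup\{ix : x\in\mathbb{R},\ x\ge 0\}$. *)

(* Defs.v *)
From HB Require Import structures.
From mathcomp Require Import all_boot all_order all_algebra.
From mathcomp Require Import complex reals ring.

Set Implicit Arguments.
Unset Strict Implicit.
Unset Printing Implicit Defensive.
Import Order.TTheory GRing.Theory Num.Theory.
Local Open Scope ring_scope.

(* DComplex w z stands for the double-complex number w + z j. *)
Record dcomplex (R : realType) := DComplex { dcfst : R[i]; dcsnd : R[i] }.

Section DoubleComplexRing.
Variable R : realType.
Implicit Types x y : dcomplex R.

Definition pair_of_dc x : R[i] * R[i] := (dcfst x, dcsnd x).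
Definition dc_of_pair (p : R[i] * R[i]) : dcomplex R := DComplex p.1 p.2.
Lemma pair_of_dcK : cancel pair_of_dc dc_of_pair.
Proof. by case. Qed.

HB.instance Definition _ := Choice.copy (dcomplex R) (can_type pair_of_dcK).

Definition dc0 : dcomplex R := DComplex 0 0.
Definition dc1 : dcomplex R := DComplex 1 0.
Definition dcopp x := DComplex (- dcfst x) (- dcsnd x).
Definition dcadd x y := DComplex (dcfst x + dcfst y) (dcsnd x + dcsnd y).
Definition dcmul x y :=
  DComplex (dcfst x * dcfst y + dcsnd x * dcsnd y)
           (dcfst x * dcsnd y + dcsnd x * dcfst y).

Lemma dcaddA : associative dcadd.
Proof. by move=> [a b] [c d] [e f]; congr DComplex; rewrite /= addrA. Qed.
Lemma dcaddC : commutative dcadd.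
Proof. by move=> [a b] [c d]; congr DComplex; rewrite /= addrC. Qed.
Lemma dcadd0 : left_id dc0 dcadd.
Proof. by move=> [a b]; congr DComplex; rewrite /= add0r. Qed.
Lemma dcaddN : left_inverse dc0 dcopp dcadd.
Proof. by move=> [a b]; congr DComplex; rewrite /= addNr. Qed.

HB.instance Definition _ :=
  GRing.isZmodule.Build (dcomplex R) dcaddA dcaddC dcadd0 dcaddN.

Lemma dcmulA : associative dcmul.
Proof. by move=> [a b] [c d] [e f]; congr DComplex => /=; ring. Qed.
Lemma dcmulC : commutative dcmul.
Proof. by move=> [a b] [c d]; congr DComplex => /=; ring. Qed.
Lemma dcmul1 : left_id dc1 dcmul.
Proof. by move=> [a b]; congr DComplex => /=; ring. Qed.
Lemma dcmulD : left_distributive dcmul dcadd.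
Proof. by move=> [a b] [c d] [e f]; congr DComplex => /=; ring. Qed.
Lemma dc1_neq0 : dc1 != 0.
Proof. by apply/eqP => -[] /eqP; rewrite oner_eq0. Qed.

HB.instance Definition _ := GRing.Zmodule_isComNzRing.Build (dcomplex R)
  dcmulA dcmulC dcmul1 dcmulD dc1_neq0.

(* (w + z j) (w - z j) = w ^ 2 - z ^ 2, so w + z j is invertible if and only if
   this complex number is nonzero. *)
Definition dcnorm x : R[i] := dcfst x ^+ 2 - dcsnd x ^+ 2.
Definition dcunit : pred (dcomplex R) := fun x => dcnorm x != 0.
Definition dcinv x :=
  if dcunit x then DComplex (dcfst x / dcnorm x) (- dcsnd x / dcnorm x) else x.

Lemma dcmulV : {in dcunit, left_inverse 1 dcinv *%R}.
Proof.
move=> [a b] u; rewrite /dcinv (_ : dcunit _ = true) //.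
move: u; rewrite /in_mem /= /dcunit /dcnorm /= => u.
by congr DComplex => /=; field.
Qed.

Lemma dcunitP x y : y * x = 1 -> dcunit x.
Proof.
case: x y => [a b] [c d] [h1 h2]; apply/negP => /eqP; rewrite /dcnorm /= => h.
have : (c * a + d * b) ^+ 2 - (c * b + d * a) ^+ 2 = 1 :> R[i].
  by rewrite h1 h2; ring.
rewrite (_ : _ - _ = (c ^+ 2 - d ^+ 2) * (a ^+ 2 - b ^+ 2)); last by ring.
by rewrite h mulr0 => /esym/eqP; rewrite oner_eq0.
Qed.

Lemma dcinv_out : {in [predC dcunit], dcinv =1 id}.
Proof. by move=> x; rewrite inE /dcinv /in_mem /= => /negbTE ->. Qed.

HB.instance Definition _ := GRing.ComNzRing_hasMulInverse.Build (dcomplex R)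
  dcmulV dcunitP dcinv_out.

End DoubleComplexRing.

Section JordanSVD.
Variable R : realType.

Definition dcC (w : R[i]) : dcomplex R := DComplex w 0.
Definition dcj : dcomplex R := DComplex 0 1.

Definition dcconj (x : dcomplex R) : dcomplex R :=
  DComplex (dcfst x) (- dcsnd x).

Definition dcadjmx m n (M : 'M[dcomplex R]_(m, n)) : 'M[dcomplex R]_(n, m) :=
  map_mx dcconj M^T.

(* [A, B] = A (1 + j) / 2 + B^T (1 - j) / 2 *)
Definition dcmx n (A B : 'M[R[i]]_n) : 'M[dcomplex R]_n :=
  ((1 + dcj) / 2%:R) *: map_mx dcC A + ((1 - dcj) / 2%:R) *: map_mx dcC B^T.

Definition dcunitary n (U : 'M[dcomplex R]_n) : Prop :=
  dcadjmx U *m U = 1%:M.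

Definition jordan_block (k : nat) (a : R[i]) : 'M[R[i]]_k :=
  \matrix_(i, j) if i == j then a else if i.+1 == j :> nat then 1 else 0.

(* A list of pairs (k, a) describes the successive blocks J_k(a). *)
Definition block_size (s : seq (nat * R[i])) (i : 'I_(size s)) : nat :=
  (tnth (in_tuple s) i).1.
Definition block_eigenvalue (s : seq (nat * R[i])) (i : 'I_(size s)) : R[i] :=
  (tnth (in_tuple s) i).2.

Definition jordan_diag (s : seq (nat * R[i])) :
    'M[R[i]]_(\sum_(i < size s) block_size i) :=
  \mxdiag_(i < size s) jordan_block (block_size i) (block_eigenvalue i).

Definition has_jordan_blocks n (J : 'M[R[i]]_n) (s : seq (nat * R[i])) : Prop :=
  all (fun b => (0 < b.1)%N) s /\
  exists e : (\sum_(i < size s) block_size i)%N = n,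
    J = castmx (e, e) (jordan_diag s).

Definition jordan_matrix n (J : 'M[R[i]]_n) : Prop :=
  exists s, has_jordan_blocks J s.

Definition eq_up_to_block_perm n (J J' : 'M[R[i]]_n) : Prop :=
  exists s s', [/\ has_jordan_blocks J s, has_jordan_blocks J' s'
                 & perm_eq s s'].

Definition jordan_svd n (M U : 'M[dcomplex R]_n) (J : 'M[R[i]]_n)
    (V : 'M[dcomplex R]_n) : Prop :=
  [/\ jordan_matrix J, dcunitary U, dcunitary V
    & M = U *m dcmx J J *m dcadjmx V].

Definition in_halfplane (z : R[i]) : Prop :=
  0 < complex.Re z \/ exists2 x : R, 0 <= x & z = (x *i)%C.

Definition eigenvalues_in_halfplane n (J : 'M[R[i]]_n) : Prop :=
  forall a, eigenvalue J a -> in_halfplane a.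

End JordanSVD.

(* Main.v *)
Require Import Defs.
From HB Require Import structures.
From mathcomp Require Import all_boot all_order all_algebra.
From mathcomp Require Import complex reals.
From mathcomp Require Import zify ring.
Set Implicit Arguments.
Unset Strict Implicit.
Unset Printing Implicit Defensive.
Import Order.TTheory GRing.Theory Num.Theory.
Local Open Scope ring_scope.

(** The maps j |-> 1 and j |-> -1 identify the double-complex numbers with
    pairs of complex numbers, and M = [A, B] with the pair (A, B).  If
    U = [P, P^-1] and V = [Q, Q^-1], the equation M = U [J, J] V^* therefore
    splits into A = P J Q^-1 and B = Q J P^-1 ([jordan_svdP]), and it forces
    A B = P J^2 P^-1.  Conversely, if J^2 = P^-1 A B P with A invertible, then
    Q := A^-1 P J solves both equations.  So the Jordan SVDs of M are the
    Jordan forms of square roots of A B.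

    Existence.  As A B is invertible, a polynomial in A B is a square root S of
    it whose eigenvalues are prescribed square roots of those of A B, hence can
    be taken in H ([mx_sqrt]): modulo the characteristic polynomial, such a
    polynomial is built by adding its roots one at a time
    ([poly_sqrt_mod]).  The Jordan form of S then gives J.

    The Jordan form itself ([jordan_form]) is obtained by splitting off one
    block at a time.  If a is a root of multiplicity k.+1 of the minimal
    polynomial of C, there are a row v and a column f, both killed by
    N ^+ k.+1 where N = C - a, with v N^k f != 0.  The rows v N^i span a Jordan
    block, and the rows orthogonal to all the columns N^i f form an invariant
    complement ([jordan_block_split]).

    Uniqueness.  The blocks of a Jordan matrix J are determined by the ranks of
    the powers (J - a)^k: their second differences in k count the blocks
    ([count_jordan_blocks]).  If a is in H and nonzero, then - a is not in H, so
    J + a is invertible and (J - a)^k has the rank of (J^2 - a^2)^k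
    ([rank_sqr_exp]).  The latter only depends on A B, to which J^2 is
    similar. *)

(** * Existence of the Jordan form *)

(** Write the minimal polynomial as q ('X - a) ^+ k.+1 with q.[a] != 0.  It does
    not divide q^2 ('X - a) ^+ k, so g N^k g != 0 for g := q.[C]; a row and a
    column of g through a nonzero entry of that product serve as v and f. *)
Lemma dual_jordan_chain (F : closedFieldType) n (C : 'M[F]_n.+1) :
  exists a k (v : 'rV[F]_n.+1) (f : 'cV[F]_n.+1), let N := C - a%:M in
  [/\ v *m N ^+ k.+1 = 0, N ^+ k.+1 *m f = 0 & v *m N ^+ k *m f != 0].
Proof.
set p := mxminpoly C.
have p_neq0 : p != 0 by rewrite monic_neq0 ?mxminpoly_monic.
have /closed_rootP[a pa0] : size p != 1%N.
  by rewrite size_mxminpoly eqSS -lt0n mxminpoly_nonconstant.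
have [m [q]] := multiplicity_XsubC p a; rewrite p_neq0 /= => qa_neq0 Dp.
case: m Dp => [|k] Dp; first by rewrite Dp expr0 mulr1 (negPf qa_neq0) in pa0.
set N := C - a%:M; set g := horner_mx C q.
have hN : horner_mx C ('X - a%:P) = N.
  by rewrite rmorphB /= horner_mx_X horner_mx_C.
have pC : g *m N ^+ k.+1 = 0.
  by rewrite -(mx_root_minpoly C) -/p Dp rmorphM rmorphXn /= hN.
have gN i : g *m N ^+ i = N ^+ i *m g.
  by rewrite -hN -rmorphXn /= mulmxE -!rmorphM mulrC.
have : g *m N ^+ k *m g != 0.
  apply/negP => /eqP h0; move/negP: (qa_neq0); apply; rewrite -dvdp_XsubCl.
  have : p %| q * ('X - a%:P) ^+ k * q.
    by apply: mxminpoly_min; rewrite !rmorphM rmorphXn /= hN.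
  (* cancel the common factor q * ('X - a%:P) ^+ k *)
  rewrite Dp exprSr mulrA dvdp_mul2l // mulf_neq0 ?expf_neq0 ?polyXsubC_eq0 //.
  by apply: contraNneq qa_neq0 => ->; rewrite root0.
case/matrix0Pn=> i [j gNg_ij]; exists a, k, (row i g), (col j g) => /=; split.
- by rewrite -row_mul pC row0.
- by rewrite !colE mulmxA -gN pC mul0mx.
apply: contra_neq gNg_ij; rewrite -row_mul colE mulmxA -row_mul -colE.
by move=> /matrixP/(_ 0 0); rewrite !mxE.
Qed.

Section JordanForm.
Variable R : realType.
Local Notation F := (R[i]).
Local Notation J := (@jordan_block R).

Lemma jordan_blockE k a : J k a = a%:M + J k 0.
Proof.
apply/matrixP => i j; rewrite !mxE.
by case: eqP => _; rewrite ?addr0 // mulr0n add0r.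
Qed.

Lemma jordan_block0E k i j : J k 0 i j = (i.+1 == j :> nat)%:R.
Proof.
rewrite mxE; case: eqP => [->|_]; last by case: eqP.
by rewrite gtn_eqF.
Qed.

Lemma jordan_chain_rows n k (a : F) (C : 'M[F]_n) (v : 'rV_n) :
  v *m (C - a%:M) ^+ k = 0 ->
  let P := \matrix_(i < k) (v *m (C - a%:M) ^+ i) in J k a *m P = P *m C.
Proof.
move=> vNk P; rewrite jordan_blockE mulmxDl mul_scalar_mx.
rewrite -[in RHS](subrK a%:M C) mulmxDr mul_mx_scalar addrC; congr (_ + _).
apply/row_matrixP => i; rewrite !row_mul rowK -mulmxA mulmxE -exprSr.
rewrite mulmx_sum_row.
under eq_bigr => j _ do rewrite rowK mxE jordan_block0E.
have [lt_ik|ge_ik] := ltnP i.+1 k.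
  rewrite (bigD1 (Ordinal lt_ik)) //= big1 ?addr0 => [|j ne_j].
    by rewrite eqxx scale1r.
  by rewrite eq_sym (negPf (ne_j : j != i.+1 :> nat)) scale0r.
have -> : i.+1 = k by apply/eqP; rewrite eqn_leq ge_ik ltn_ord.
by rewrite vNk big1 // => j _; rewrite gtn_eqF ?ltn_ord // scale0r.
Qed.

(** Columns have to be listed from the highest power of C - a down to the zeroth
    for the same upper triangular block to act on their right. *)
Lemma jordan_chain_cols n k (a : F) (C : 'M[F]_n) (f : 'cV_n) :
  (C - a%:M) ^+ k *m f = 0 ->
  let Q := \matrix_(i < n, j < k) ((C - a%:M) ^+ (k - j.+1) *m f) i 0 in
  C *m Q = Q *m J k a.
Proof.
move=> Nkf Q; rewrite jordan_blockE mulmxDr mul_mx_scalar.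
rewrite -[in LHS](subrK a%:M C) mulmxDl mul_scalar_mx addrC; congr (_ + _).
set N := C - a%:M in Nkf Q *.
have colQ j : col j Q = N ^+ (k - j.+1) *m f.
  by apply/matrixP => i i0; rewrite !mxE (ord1 i0).
suff colNQ j : col j (N *m Q) = col j (Q *m J k 0).
  by apply/matrixP => i j; have /matrixP/(_ i 0) := colNQ j; rewrite !mxE.
rewrite colE -mulmxA -colE colQ mulmxA mulmxE -exprS subnSK ?ltn_ord //.
have -> : col j (Q *m J k 0) = \sum_i J k 0 i j *: col i Q.
  apply/matrixP => l l0; rewrite mxE summxE !mxE; apply: eq_bigr => i _.
  by rewrite !mxE mulrC.
under eq_bigr => i _ do rewrite colQ jordan_block0E.
case: j => [[|j] lt_jk] /=.
  by rewrite subn0 Nkf big1 // => i _; rewrite scale0r.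
pose j' := Ordinal (ltnW lt_jk).
rewrite (bigD1 j') //= big1 ?addr0 => [|i ne_i]; first by rewrite eqxx scale1r.
by rewrite eqSS (negPf (ne_i : i != j :> nat)) scale0r.
Qed.

(** P lists the rows v N^i and Q the columns N^(k - j) f of a dual chain.  Their
    product is triangular with the nonzero diagonal entries v N^k f, so the
    kernel of Q is a complement of P; it is invariant because C Q = Q J. *)
Lemma jordan_block_split n (C : 'M[F]_n.+1) :
  exists a k m (P : 'M[F]_(k.+1, n.+1)) (K : 'M[F]_(m, n.+1)) (C' : 'M[F]_m),
  [/\ (k.+1 + m = n.+1)%N, row_free (col_mx P K), J k.+1 a *m P = P *m C
    & K *m C = C' *m K].
Proof.
have [a [k [v [f /= [vN Nf vNf]]]]] := dual_jordan_chain C.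
have /= PC := jordan_chain_rows vN; have /= CQ := jordan_chain_cols Nf.
set N := C - a%:M in vN Nf vNf PC CQ.
set P := (\matrix_(i < k.+1) (v *m N ^+ i)) in PC.
set Q := (\matrix_(i, j) _) in CQ.
have PQE i j : (P *m Q) i j = (v *m N ^+ (i + (k.+1 - j.+1)) *m f) 0 0.
  rewrite exprD -mulmxE mulmxA -mulmxA !mxE.
  by apply: eq_bigr => l _; rewrite !mxE.
have PQu : P *m Q \in unitmx.
  rewrite unitmxE -det_tr det_trig.
    rewrite unitfE; apply/prodf_neq0 => i _; rewrite mxE PQE.
    have -> : (i + (k.+1 - i.+1) = k)%N by rewrite subSS subnKC // -ltnS.
    apply: contra_neq vNf => h; apply/matrixP => x y.
    by rewrite (ord1 x) (ord1 y) h mxE.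
  apply/is_trig_mxP => i j lt_ij; rewrite mxE PQE.
  have -> : (j + (k.+1 - i.+1) = k.+1 + (j - i.+1))%N.
    by rewrite addnBA ?ltn_ord // addnBA // addnC.
  by rewrite exprD -mulmxE mulmxA vN !mul0mx mxE.
have rkQ : \rank Q = k.+1.
  apply/eqP; rewrite eqn_leq rank_leq_col -{1}(mxrank_unit PQu).
  exact: mxrankM_maxr.
have [m [K [Dm freeK defK]]] : exists m (K : 'M_(m, n.+1)),
    [/\ (k.+1 + m = n.+1)%N, row_free K & (K :=: kermx Q)%MS].
  exists (\rank (kermx Q)), (row_base (kermx Q)).
  split; [|exact: row_base_free|exact: eq_row_base].
  by rewrite mxrank_ker rkQ subnKC // -rkQ rank_leq_row.
have KQ : K *m Q = 0 by apply/sub_kermxP; rewrite defK.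
exists a, k, m, P, K, (K *m C *m pinvmx K); split => //.
- apply: inj_row_free => w; rewrite -[w]hsubmxK mul_row_col => w0.
  have w1 : lsubmx w = 0.
    apply: (row_free_inj (A := P *m Q)); first by rewrite row_free_unit.
    have : (lsubmx w *m P + rsubmx w *m K) *m Q = 0 by rewrite w0 mul0mx.
    by rewrite mulmxDl -!mulmxA KQ mulmx0 addr0 /= mul0mx.
  have w2 : rsubmx w = 0.
    apply: (row_free_inj freeK).
    by move: w0; rewrite w1 mul0mx add0r /= mul0mx.
  by rewrite w1 w2 row_mx0.
rewrite mulmxKpV // defK; apply/sub_kermxP.
by rewrite -mulmxA CQ mulmxA KQ mul0mx.
Qed.

(** Recursion over the list of blocks replaces the block diagonal matrix indexed
    by ordinals, which does not unfold along a cons. *)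
Fixpoint jordan_sum (s : seq (nat * F)) : 'M[F]_(sumn (unzip1 s)) :=
  if s is b :: s' then block_mx (J b.1 b.2) 0 0 (jordan_sum s') else 0.

Lemma mxdiag_jordan m (p : 'I_m -> nat) (a : 'I_m -> F) :
  let s := [seq (p i, a i) | i <- enum 'I_m] in
  exists e : sumn (unzip1 s) = (\sum_(i < m) p i)%N,
  \mxdiag_(i < m) J (p i) (a i) = castmx (e, e) (jordan_sum s).
Proof.
elim: m p a => [|m IHm] p a /=.
  have e0 : sumn (unzip1 [seq (p i, a i) | i <- enum 'I_0])
            = (\sum_(i < 0) p i)%N by rewrite big_ord0 enum_ord0.
  exists e0; apply/matrixP => i.
  by have := ltn_ord i; rewrite [X in (_ < X)%N]big_ord0.
have [e' De'] := IHm (p \o lift ord0) (a \o lift ord0).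
rewrite mxdiag_recl enum_ordSl /= -map_comp.
move: De'; rewrite /= => ->.
case: _ / mxsize_recl => /=; rewrite castmx_id.
case: _ / e'; rewrite castmx_id /=.
by exists erefl; rewrite castmx_id.
Qed.

Lemma jordan_diagE (s : seq (nat * F)) :
  exists e : sumn (unzip1 s) = (\sum_(i < size s) block_size i)%N,
  jordan_diag s = castmx (e, e) (jordan_sum s).
Proof.
have := mxdiag_jordan (@block_size R s) (@block_eigenvalue R s).
have -> // : [seq (block_size i, block_eigenvalue i) | i <- enum 'I_(size s)] = s.
rewrite -[RHS](map_tnth_enum (in_tuple s)); apply: eq_map => i.
by rewrite /block_size /block_eigenvalue -surjective_pairing.
Qed.

Lemma has_jordan_blocksP n (A : 'M[F]_n) s :
  has_jordan_blocks A s <->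
  all (fun b => (0 < b.1)%N) s /\
  exists e : sumn (unzip1 s) = n, A = castmx (e, e) (jordan_sum s).
Proof.
rewrite /has_jordan_blocks; have [e0 ->] := jordan_diagE s.
split=> -[s_gt0 [e ->]]; split=> //.
  by exists (etrans e0 e); rewrite castmx_comp.
exists (etrans (esym e0) e); rewrite castmx_comp.
by congr castmx; congr pair; apply: eq_irrelevance.
Qed.

(** The change of basis P is kept rectangular, with the sum of the block sizes as
    its height, so that no cast interferes with the induction. *)
Lemma jordan_sum_basis n (C : 'M[F]_n) :
  exists s (P : 'M[F]_(sumn (unzip1 s), n)),
  [/\ all (fun b => (0 < b.1)%N) s, sumn (unzip1 s) = n, row_free P
    & jordan_sum s *m P = P *m C].
Proof.
elim/ltn_ind: n C => -[|n] IHn C.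
  by exists [::], 0; split => //; rewrite ?/row_free ?mxrank0 ?mulmx0 ?mul0mx.
have [a [k [m [P [K [C' [Dn freePK PC KC]]]]]]] := jordan_block_split C.
have [|s [Q [s_gt0 Dm freeQ QC]]] := IHn m _ C'.
  by rewrite -Dn addSn ltnS leq_addl.
exists ((k.+1, a) :: s), (col_mx P (Q *m K)); split => //=; first by rewrite Dm.
  apply: inj_row_free => w.
  rewrite -[w]hsubmxK mul_row_col mulmxA -mul_row_col => w0.
  move: w0; rewrite -[RHS](mul0mx _ (col_mx P K)) => /(row_free_inj freePK).
  rewrite -row_mx0 => /eq_row_mx[w1 w2].
  have /(row_free_inj freeQ) w3 : rsubmx w *m Q = 0 *m Q by rewrite w2 mul0mx.
  by rewrite w1 w3 row_mx0.
by rewrite mul_block_col !mul0mx addr0 add0r mul_col_mx PC -!mulmxA KC !mulmxA QC.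
Qed.

Theorem jordan_form n (C : 'M[F]_n) :
  exists (A P : 'M[F]_n),
  [/\ jordan_matrix A, P \in unitmx & A *m P = P *m C].
Proof.
have [s [P [s_gt0 e freeP PC]]] := jordan_sum_basis C.
exists (castmx (e, e) (jordan_sum s)), (castmx (e, erefl) P); split.
- by exists s; apply/has_jordan_blocksP; split => //; exists e.
- by rewrite -row_free_unit row_free_castmx.
by case: _ / e C P freeP PC => C P _ PC; rewrite !castmx_id.
Qed.

End JordanForm.

(** * Square roots of invertible matrices *)

(** A Hensel lift combined with Lagrange interpolation.  If p divides q^2 - X,
    replace q by q + t p with a constant t; then p still divides
    (q + t p)^2 - X, and t is chosen to gain the further factor 'X - c.  When c
    is already a root of p, this is a linear equation for t with leading
    coefficient 2 q.[c] != 0; otherwise t is determined by prescribing the value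
    h c at c. *)
Lemma poly_sqrt_mod (F : fieldType) (h : F -> F) (rs : seq F) :
  2%:R != 0 :> F -> (forall c, h c ^+ 2 = c) -> 0 \notin rs ->
  exists q : {poly F}, (\prod_(c <- rs) ('X - c%:P) %| q ^+ 2 - 'X)
    /\ {in rs, forall c, q.[c] = h c}.
Proof.
move=> nz2 hK; elim: rs => [|c rs IHrs] nz_rs.
  by exists 0; rewrite big_nil dvd1p.
move: nz_rs; rewrite inE negb_or eq_sym => /andP[nz_c /IHrs[q [/dvdpP[r Dr] qh]]].
set p := \prod_(d <- rs) _ in Dr.
have p0 d : d \in rs -> p.[d] = 0.
  by move=> rs_d; apply/eqP; rewrite -/(root p d) root_prod_XsubC.
suff [t tc0 tch] : exists2 t, (r + t%:P * q *+ 2 + t%:P ^+ 2 * p).[c] = 0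
                      & (q + t%:P * p).[c] = h c.
  exists (q + t%:P * p); split=> [|d].
    have -> : (q + t%:P * p) ^+ 2 - 'X
              = (q ^+ 2 - 'X) + (t%:P * q *+ 2 + t%:P ^+ 2 * p) * p by ring.
    rewrite big_cons Dr -mulrDl addrA dvdp_mul // dvdp_XsubCl.
    exact/eqP.
  rewrite inE => /predU1P[-> //|rs_d].
  by rewrite !hornerE p0 // mulr0 addr0 qh.
have [rs_c|rs'c] := boolP (c \in rs).
  have nz_hc : h c != 0.
    by apply: contraNneq nz_c => hc0; rewrite -(hK c) hc0 expr0n.
  exists (- r.[c] / (2%:R * h c));
    rewrite !(hornerD, hornerM, hornerMn, hornerC) p0 // qh // ?mulr0 ?addr0 //.
  by field; apply/andP.
have nz_pc : p.[c] != 0 by rewrite -/(root p c) root_prod_XsubC.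
have tch : (q + ((h c - q.[c]) / p.[c])%:P * p).[c] = h c.
  by rewrite !hornerE divfK // addrC subrK.
exists ((h c - q.[c]) / p.[c]) => //; set t := _ / _ in tch *.
apply: (mulIf nz_pc); rewrite mul0r -hornerM.
have -> : (r + t%:P * q *+ 2 + t%:P ^+ 2 * p) * p = (q + t%:P * p) ^+ 2 - 'X.
  by rewrite 2!mulrDl -Dr; ring.
by rewrite hornerD hornerN hornerX horner_exp tch hK subrr.
Qed.

(** The root is S = q.[A], where q is a square root of X modulo the
    characteristic polynomial of A.  The polynomial \prod_c (q - h c) is a
    multiple of that characteristic polynomial, so \prod_c (X - h c)
    annihilates S and only the h c can be eigenvalues of S. *)
Lemma mx_sqrt (F : closedFieldType) (h : F -> F) n (A : 'M[F]_n) :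
  2%:R != 0 :> F -> (forall c, h c ^+ 2 = c) -> A \in unitmx ->
  exists2 S : 'M[F]_n, S *m S = A
    & forall a, eigenvalue S a -> exists c, a = h c.
Proof.
move=> nz2 hK; case: n A => [|n] A uA.
  exists A => [|a /eigenvalueP[v _]]; last by rewrite thinmx0 eqxx.
  by rewrite [LHS]flatmx0 [RHS]flatmx0.
have [rs] := closed_field_poly_normal (char_poly A).
rewrite (monicP (char_poly_monic A)) scale1r => Drs.
have nz_rs : 0 \notin rs.
  rewrite -root_prod_XsubC -Drs -eigenvalue_root_char.
  apply/eigenvalueP => -[v]; rewrite scale0r => vA0 /eqP[].
  by rewrite -(mulmxK uA v) vA0 mul0mx.
have [q [q2 qh]] := poly_sqrt_mod nz2 hK nz_rs.
exists (horner_mx A q) => [|a].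
  apply/eqP; rewrite mulmxE -subr_eq0 -expr2 -{2}(horner_mx_X A).
  rewrite -rmorphXn -rmorphB /=; move: q2; rewrite -Drs => /dvdpP[r ->].
  by rewrite rmorphM /= Cayley_Hamilton mulr0.
rewrite eigenvalue_root_min => min0.
have S0 : horner_mx (horner_mx A q) (\prod_(c <- rs) ('X - (h c)%:P)) = 0.
  have -> : horner_mx (horner_mx A q) (\prod_(c <- rs) ('X - (h c)%:P))
            = horner_mx A (\prod_(c <- rs) (q - (h c)%:P)).
    rewrite !rmorph_prod; apply: eq_bigr => c _.
    by rewrite !rmorphB /= horner_mx_X !horner_mx_C.
  have /dvdpP[r ->] : char_poly A %| \prod_(c <- rs) (q - (h c)%:P).
    rewrite Drs; elim: (rs) qh => [|c s IHs] qh; first by rewrite !big_nil.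
    rewrite !big_cons dvdp_mul ?IHs // => [|d sd]; last first.
      by rewrite qh // inE sd orbT.
    by rewrite dvdp_XsubCl rootE !hornerE qh ?inE ?eqxx // subrr.
  by rewrite rmorphM /= Cayley_Hamilton mulr0.
have := dvdp_trans (_ : 'X - a%:P %| _) (mxminpoly_min S0).
rewrite dvdp_XsubCl => /(_ min0).
rewrite -(big_map h xpredT (fun c => 'X - c%:P)) dvdp_XsubCl root_prod_XsubC.
by case/mapP => c _ ->; exists c.
Qed.

Section HalfPlane.
Variable R : realType.
Implicit Type z : R[i].

Definition halfplane_sqrt z : R[i] :=
  let s := sqrtc z in
  if (0 < complex.Re s) || (complex.Re s == 0) && (0 <= complex.Im s)
  then s else - s.

Lemma halfplane_sqrtK z : halfplane_sqrt z ^+ 2 = z.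
Proof. by rewrite /halfplane_sqrt; case: ifP; rewrite ?sqrrN sqr_sqrtc. Qed.

Lemma halfplane_sqrt_in z : in_halfplane (halfplane_sqrt z).
Proof.
rewrite /halfplane_sqrt /in_halfplane; case: (sqrtc z) => x y /=.
case: ifPn => [/orP[x_gt0|/andP[/eqP-> y_ge0]]|]; first by left.
  by right; exists y.
rewrite negb_or -leNgt le_eqVlt negb_and -ltNge => /andP[/predU1P[->|x_lt0]].
  rewrite eqxx /= => y_lt0; right; exists (- y); first by rewrite oppr_ge0 ltW.
  by apply/eqP; rewrite eq_complex /= oppr0 !eqxx.
by left; rewrite oppr_gt0.
Qed.

Lemma halfplane_opp0 z : in_halfplane z -> in_halfplane (- z) -> z = 0.
Proof.
case: z => x y [/= x_gt0|[t t_ge0 [-> ->]]] [/=|[u u_ge0 []]].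
- by rewrite oppr_gt0 ltNge ltW.
- by move=> /eqP; rewrite oppr_eq0 => /eqP x0; rewrite x0 ltxx in x_gt0.
- by rewrite oppr0 ltxx.
move=> _ /= tu; suff -> : t = 0 by [].
by apply/eqP; rewrite eq_le t_ge0 andbT -oppr_ge0 tu.
Qed.

End HalfPlane.

(** * Ranks determine the Jordan blocks *)

Lemma unitmx_exp (F : comUnitRingType) n (A : 'M[F]_n) k :
  A \in unitmx -> A ^+ k \in unitmx.
Proof.
move=> uA; elim: k => [|k IHk]; first by rewrite expr0 unitmx1.
by rewrite exprS -mulmxE unitmx_mul uA.
Qed.

Section JordanRanks.
Variable R : realType.
Local Notation F := (R[i]).
Local Notation J := (@jordan_block R).

Lemma jordan_block_exp m k (i j : 'I_m) :
  (J m 0 ^+ k) i j = (i + k == j)%N%:R.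
Proof.
elim: k i => [|k IHk] i; first by rewrite expr0 addn0 mxE.
rewrite exprS -mulmxE mxE; under eq_bigr => l _ do rewrite jordan_block0E IHk.
have [lt_im|ge_im] := ltnP i.+1 m.
  rewrite (bigD1 (Ordinal lt_im)) //= big1 ?addr0 => [|l ne_l].
    by rewrite eqxx mul1r addSnnS.
  by rewrite eq_sym (negPf (ne_l : l != i.+1 :> nat)) mul0r.
rewrite big1 => [|l _]; last by rewrite gtn_eqF ?mul0r // (leq_trans _ ge_im).
rewrite gtn_eqF // (leq_trans (ltn_ord j)) // (leq_trans ge_im) //.
by rewrite addnS ltnS leq_addr.
Qed.

(** The k-th power of the nilpotent block factors as L^T T, where the rows of L
    are the first m - k unit vectors and those of T the last m - k ones: both
    have full rank. *)
Lemma rank_jordan_block_exp m k : \rank (J m 0 ^+ k) = (m - k)%N.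
Proof.
pose L := \matrix_(i < m - k, j < m) (i == j :> nat)%:R : 'M[F]_(m - k, m).
pose T := \matrix_(i < m - k, j < m) (i + k == j)%N%:R : 'M[F]_(m - k, m).
have shift_free d : (d <= k)%N ->
    row_free (\matrix_(i < m - k, j < m) (i + d == j)%N%:R : 'M[F]_(m - k, m)).
  move=> le_dk; apply/row_freeP.
  exists (\matrix_(i < m, j < m - k) (j + d == i)%N%:R).
  apply/matrixP => i j; rewrite !mxE.
  have lt_im : (i + d < m)%N by have := ltn_ord i; lia.
  rewrite (bigD1 (Ordinal lt_im)) //= big1 ?addr0 => [|l ne_l].
    by rewrite !mxE eqxx mul1r eqn_add2r eq_sym val_eqE.
  by rewrite !mxE eq_sym (negPf (ne_l : l != (i + d)%N :> nat)) mul0r.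
have freeL : row_free L.
  have -> : L = \matrix_(i < m - k, j < m) (i + 0 == j)%N%:R.
    by apply/matrixP => i j; rewrite !mxE addn0.
  exact: shift_free.
have -> : J m 0 ^+ k = L^T *m T.
  apply/matrixP => i j; rewrite jordan_block_exp mxE.
  under eq_bigr => l _ do rewrite !mxE.
  have [lt_im|ge_im] := ltnP i (m - k).
    rewrite (bigD1 (Ordinal lt_im)) //= big1 ?addr0 => [|l ne_l].
      by rewrite eqxx mul1r.
    by rewrite (negPf (ne_l : l != i :> nat)) mul0r.
  rewrite big1 => [|l _]; last by rewrite ltn_eqF ?mul0r // (leq_trans _ ge_im).
  by rewrite gtn_eqF //; have := ltn_ord j; lia.
by rewrite mxrankMfree ?shift_free // mxrank_tr (eqP freeL).
Qed.

Lemma unitmx_jordan_block m a : a != 0 -> J m a \in unitmx.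
Proof.
move=> nz_a; rewrite unitmxE unitfE -det_tr det_trig.
  by apply/prodf_neq0 => i _; rewrite !mxE eqxx.
apply/is_trig_mxP => i j lt_ij; rewrite !mxE -val_eqE /= gtn_eqF //.
by rewrite gtn_eqF // ltnS ltnW.
Qed.

Lemma rank_jordan_block m a b k :
  \rank ((J m a - b%:M) ^+ k) = if a == b then (m - k)%N else m.
Proof.
have -> : J m a - b%:M = J m (a - b).
  apply/matrixP => i j; rewrite !mxE.
  by case: (i == j); rewrite ?mulr0n ?subr0.
case: eqVneq => [->|ne_ab]; first by rewrite subrr rank_jordan_block_exp.
have : J m (a - b) \in unitmx by rewrite unitmx_jordan_block // subr_eq0.
by move=> /(unitmx_exp k) /mxrank_unit.
Qed.

Lemma block_diag_mx_exp (T : pzRingType) m n (A : 'M[T]_m) (B : 'M[T]_n) k :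
  block_mx A 0 0 B ^+ k = block_mx (A ^+ k) 0 0 (B ^+ k).
Proof.
elim: k => [|k IHk]; first by rewrite !expr0 -scalar_mx_block.
by rewrite !exprS IHk -!mulmxE mulmx_block !mulmx0 !mul0mx !addr0 add0r.
Qed.

Lemma rank_jordan_sum s (a : F) k :
  \rank ((jordan_sum s - a%:M) ^+ k)
  = sumn [seq if b.2 == a then (b.1 - k)%N else b.1 | b <- s].
Proof.
elim: s => [|b s IHs] /=; first by apply/eqP; rewrite -leqn0 rank_leq_row.
rewrite scalar_mx_block opp_block_mx add_block_mx !oppr0 !addr0.
by rewrite block_diag_mx_exp rank_diag_block_mx rank_jordan_block IHs.
Qed.

(** A block of size m and eigenvalue a contributes m - k to the rank of the k-th
    power, and this convex function of k bends exactly at k = m; the other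
    blocks contribute a constant. *)
Lemma count_jordan_blocks (s : seq (nat * F)) (a : F) k :
  let r l := \rank ((jordan_sum s - a%:M) ^+ l) in
  (count_mem (k.+1, a) s + 2 * r k.+1 = r k + r k.+2)%N.
Proof.
rewrite /= !rank_jordan_sum; elim: s => [|[m b] s IHs] //=.
move: IHs.
set r := fun l => sumn [seq if b.2 == a then (b.1 - l)%N else b.1 | b <- s].
rewrite -/(r k) -/(r k.+1) -/(r k.+2) xpair_eqE /=.
move: (count_mem _ s) (r k) (r k.+1) (r k.+2) => c r0 r1 r2.
case: (b == a); rewrite ?andbT ?andbF /=; last by lia.
by case: (m =P k.+1) => [->|] /=; lia.
Qed.

Lemma perm_jordan_blocks (s s' : seq (nat * F)) :
  all (fun b => (0 < b.1)%N) s -> all (fun b => (0 < b.1)%N) s' ->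
  (forall a k, \rank ((jordan_sum s - a%:M) ^+ k)
               = \rank ((jordan_sum s' - a%:M) ^+ k)) ->
  perm_eq s s'.
Proof.
move=> s_gt0 s'_gt0 eq_r; apply/allP => -[[|k] a] _ /=; apply/eqP.
  have no0 t : all (fun b => (0 < b.1)%N) t -> count_mem (0%N, a) t = 0%N.
    by move=> /allP t_gt0; apply/count_memPn/negP => /t_gt0.
  by rewrite !no0.
have := count_jordan_blocks s a k; rewrite /= !eq_r.
by have /= <- := count_jordan_blocks s' a k => /addIn.
Qed.

End JordanRanks.

(** * The two components of a double-complex matrix *)

Section Components.
Variable R : realType.
Local Notation F := (R[i]).

(** The two ring morphisms to the complex numbers: j |-> 1 and j |-> -1. *)
Definition dcplus (x : dcomplex R) : F := dcfst x + dcsnd x.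
Definition dcminus (x : dcomplex R) : F := dcfst x - dcsnd x.

Lemma dcplus_zmod_morphism : zmod_morphism dcplus.
Proof. by move=> [a b] [c d]; rewrite /dcplus /=; ring. Qed.
Lemma dcplus_monoid_morphism : monoid_morphism dcplus.
Proof. by split=> [|[a b] [c d]]; rewrite /dcplus /=; ring. Qed.
HB.instance Definition _ := GRing.isZmodMorphism.Build (dcomplex R) F dcplus
  dcplus_zmod_morphism.
HB.instance Definition _ := GRing.isMonoidMorphism.Build (dcomplex R) F dcplus
  dcplus_monoid_morphism.

Lemma dcminus_zmod_morphism : zmod_morphism dcminus.
Proof. by move=> [a b] [c d]; rewrite /dcminus /=; ring. Qed.
Lemma dcminus_monoid_morphism : monoid_morphism dcminus.
Proof. by split=> [|[a b] [c d]]; rewrite /dcminus /=; ring. Qed.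
HB.instance Definition _ := GRing.isZmodMorphism.Build (dcomplex R) F dcminus
  dcminus_zmod_morphism.
HB.instance Definition _ := GRing.isMonoidMorphism.Build (dcomplex R) F dcminus
  dcminus_monoid_morphism.

Variable n : nat.
Implicit Types (A B : 'M[F]_n) (M U : 'M[dcomplex R]_n).

(** The matrices A and B in M = [A, B]. *)
Definition dcmxl M : 'M[F]_n := map_mx dcplus M.
Definition dcmxr M : 'M[F]_n := (map_mx dcminus M)^T.

Lemma dcmx_ext M U : dcmxl M = dcmxl U -> dcmxr M = dcmxr U -> M = U.
Proof.
move=> /matrixP eql /matrixP eqr; apply/matrixP => i j.
move: (eql i j) (eqr j i); rewrite !mxE /dcplus /dcminus.
case: (M i j) (U i j) => [a b] [c d] /= s t.
have nz2 : 2%:R != 0 :> F by rewrite pnatr_eq0.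
congr DComplex; apply: (mulfI nz2).
  by transitivity ((a + b) + (a - b)); [ring | rewrite s t; ring].
by transitivity ((a + b) - (a - b)); [ring | rewrite s t; ring].
Qed.

Lemma dcmxlM M U : dcmxl (M *m U) = dcmxl M *m dcmxl U.
Proof. exact: map_mxM. Qed.

Lemma dcmxrM M U : dcmxr (M *m U) = dcmxr U *m dcmxr M.
Proof. by rewrite /dcmxr map_mxM trmx_mul. Qed.

Lemma dcmxl1 : dcmxl 1%:M = 1%:M.
Proof. exact: map_mx1. Qed.

Lemma dcmxr1 : dcmxr 1%:M = 1%:M.
Proof. by rewrite /dcmxr map_mx1 trmx1. Qed.

Lemma dc2_unit : (2%:R : dcomplex R) \is a GRing.unit.
Proof.
have h2 : dcC 2%:R^-1 * 2%:R = 1 :> dcomplex R.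
  have nz2 : 2%:R != 0 :> F by rewrite pnatr_eq0.
  by congr DComplex => /=; [field|ring].
by apply/unitrP; exists (dcC 2%:R^-1); split; rewrite // mulrC.
Qed.

Lemma dcmxlE A B : dcmxl (dcmx A B) = A.
Proof.
have nz2 : 2%:R != 0 :> F by rewrite pnatr_eq0.
apply/matrixP => i j; rewrite !mxE rmorphD !rmorphM !rmorphV ?dc2_unit //=.
by rewrite rmorphD rmorphB rmorph_nat rmorph1 /= /dcplus /=; field.
Qed.

Lemma dcmxrE A B : dcmxr (dcmx A B) = B.
Proof.
have nz2 : 2%:R != 0 :> F by rewrite pnatr_eq0.
apply/matrixP => i j; rewrite !mxE rmorphD !rmorphM !rmorphV ?dc2_unit //=.
by rewrite rmorphD rmorphB rmorph_nat rmorph1 /= /dcminus /=; field.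
Qed.

Lemma dcmxl_adj U : dcmxl (dcadjmx U) = dcmxr U.
Proof. by apply/matrixP => i j; rewrite !mxE. Qed.

Lemma dcmxr_adj U : dcmxr (dcadjmx U) = dcmxl U.
Proof. by apply/matrixP => i j; rewrite !mxE /dcminus /= opprK. Qed.

Lemma dcunitaryP U : dcunitary U <-> dcmxr U *m dcmxl U = 1%:M.
Proof.
split=> [/(congr1 dcmxl)|h]; first by rewrite dcmxlM dcmxl_adj dcmxl1.
apply: dcmx_ext; rewrite ?dcmxlM ?dcmxrM ?dcmxl_adj ?dcmxr_adj.
  by rewrite h dcmxl1.
by rewrite h dcmxr1.
Qed.

Lemma jordan_svdP M U J V :
  jordan_svd M U J V <->
  [/\ jordan_matrix J, dcmxr U *m dcmxl U = 1%:M, dcmxr V *m dcmxl V = 1%:M,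
      dcmxl M = dcmxl U *m J *m dcmxr V & dcmxr M = dcmxl V *m J *m dcmxr U].
Proof.
split=> [[jJ /dcunitaryP hU /dcunitaryP hV ->]|[jJ hU hV hl hr]].
  split=> //; first by rewrite !dcmxlM dcmxl_adj dcmxlE.
  by rewrite !dcmxrM dcmxr_adj dcmxrE mulmxA.
split=> //; try exact/dcunitaryP.
apply: dcmx_ext; first by rewrite hl !dcmxlM dcmxl_adj dcmxlE.
by rewrite hr !dcmxrM dcmxr_adj dcmxrE mulmxA.
Qed.

End Components.

(** * Uniqueness of the square root *)

Section Ranks.
Variables (F : fieldType) (n : nat).
Implicit Types (A P Q : 'M[F]_n) (a b : F).

Lemma rank_conj_exp P Q A b k : Q *m P = 1%:M ->
  \rank ((P *m A *m Q - b%:M) ^+ k) = \rank ((A - b%:M) ^+ k).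
Proof.
move=> QP; have PQ := mulmx1C QP; have [uQ uP] := mulmx1_unit QP.
have -> : (P *m A *m Q - b%:M) ^+ k = P *m (A - b%:M) ^+ k *m Q.
  have -> : P *m A *m Q - b%:M = P *m (A - b%:M) *m Q.
    by rewrite mulmxBr mulmxBl mul_mx_scalar -scalemxAl PQ scalemx1.
  elim: k => [|k IHk]; first by rewrite !expr0 mulmx1 PQ.
  by rewrite !exprS IHk -!mulmxE !mulmxA -[_ *m Q *m P]mulmxA QP mulmx1.
rewrite mxrankMfree ?row_free_unit //.
by rewrite -mxrank_tr trmx_mul mxrankMfree ?mxrank_tr // row_free_unit unitmx_tr.
Qed.

Lemma unitmx_not_eigenvalue A a : ~~ eigenvalue A a -> A - a%:M \in unitmx.
Proof. by rewrite negbK -row_free_unit -kermx_eq0. Qed.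

(** In A^2 - a^2 = (A - a) (A + a) the second factor is invertible. *)
Lemma rank_sqr_exp A a k : ~~ eigenvalue A (- a) ->
  \rank ((A *m A - (a ^+ 2)%:M) ^+ k) = \rank ((A - a%:M) ^+ k).
Proof.
move=> /unitmx_not_eigenvalue; rewrite raddfN opprK => uAa.
have commA : GRing.comm (A - a%:M) (A + a%:M).
  apply: commrD; apply/commr_sym; apply: commrB => //;
    by rewrite /GRing.comm -?mulmxE ?scalar_mxC.
have -> : A *m A - (a ^+ 2)%:M = (A - a%:M) * (A + a%:M).
  rewrite -!mulmxE mulmxDr !mulmxBl scalar_mxC addrA subrK.
  by rewrite -scalar_mxM.
by rewrite exprMn_comm // -mulmxE mxrankMfree // row_free_unit unitmx_exp.
Qed.

End Ranks.

Lemma jordan_matrix_rank (R : realType) n (J J' : 'M[R[i]]_n) :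
  jordan_matrix J -> jordan_matrix J' ->
  (forall a k, \rank ((J - a%:M) ^+ k) = \rank ((J' - a%:M) ^+ k)) ->
  eq_up_to_block_perm J J'.
Proof.
move=> [s Js] [s' Js'] eq_r; exists s, s'; split => //.
have [s_gt0 [e De]] := (has_jordan_blocksP _ _).1 Js.
have [s'_gt0 [e' De']] := (has_jordan_blocksP _ _).1 Js'.
have rk t (f : sumn (unzip1 t) = n) a k :
    \rank ((castmx (f, f) (@jordan_sum R t) - a%:M) ^+ k)
    = \rank ((jordan_sum t - a%:M) ^+ k).
  by case: _ / f; rewrite castmx_id.
apply: perm_jordan_blocks => // a k.
by rewrite -(rk _ e) -(rk _ e') -De -De'.
Qed.

(** For a nonzero eigenvalue a of J or J', the number - a lies outside of H and
    is an eigenvalue of neither, which gives the ranks from those of J^2 and J'^2.  All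
    other a, as well as 0, make J - a and J' - a invertible. *)
Lemma halfplane_sqr_rank (R : realType) n (J J' : 'M[R[i]]_n) :
  J \in unitmx -> J' \in unitmx ->
  eigenvalues_in_halfplane J -> eigenvalues_in_halfplane J' ->
  (forall b k, \rank ((J *m J - b%:M) ^+ k) = \rank ((J' *m J' - b%:M) ^+ k)) ->
  forall a k, \rank ((J - a%:M) ^+ k) = \rank ((J' - a%:M) ^+ k).
Proof.
move=> uJ uJ' HJ HJ' eq_r a k.
have [a0|nz_a] := eqVneq a 0.
  by rewrite a0 raddf0 !subr0 !mxrank_unit ?unitmx_exp.
have [|] := boolP (eigenvalue J a || eigenvalue J' a).
  move=> eig; have Ha : in_halfplane a by case/orP: eig => [/HJ|/HJ'].
  have notN (A : 'M[R[i]]_n) :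
      eigenvalues_in_halfplane A -> ~~ eigenvalue A (- a).
    by move=> HA; apply: contraNN nz_a => /HA HNa; apply/eqP/halfplane_opp0.
  by rewrite -(rank_sqr_exp k (notN J HJ)) -(rank_sqr_exp k (notN J' HJ')).
rewrite negb_or.
move=> /andP[/unitmx_not_eigenvalue uJa /unitmx_not_eigenvalue uJ'a].
by rewrite !mxrank_unit ?unitmx_exp.
Qed.

(** * The Jordan singular value decomposition *)

Theorem theorem6p3 (R : realType) (n : nat) (A B : 'M[R[i]]_n)
    (M : 'M[dcomplex R]_n) (M_def : M = dcmx A B) (M_inv : M \in unitmx) :
  (exists (U : 'M[dcomplex R]_n) (J : 'M[R[i]]_n) (V : 'M[dcomplex R]_n),
      jordan_svd M U J V /\ eigenvalues_in_halfplane J) /\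
  (forall (U U' V V' : 'M[dcomplex R]_n) (J J' : 'M[R[i]]_n),
      jordan_svd M U J V -> jordan_svd M U' J' V' ->
      eigenvalues_in_halfplane J -> eigenvalues_in_halfplane J' ->
      eq_up_to_block_perm J J').
Proof.
have Ml : dcmxl M = A by rewrite M_def dcmxlE.
have Mr : dcmxr M = B by rewrite M_def dcmxrE.
have [uA _] : A \in unitmx /\ dcmxl (invmx M) \in unitmx.
  by apply: mulmx1_unit; rewrite -Ml -dcmxlM mulmxV // dcmxl1.
have [_ uB] : dcmxr (invmx M) \in unitmx /\ B \in unitmx.
  by apply: mulmx1_unit; rewrite -Mr -dcmxrM mulmxV // dcmxr1.
split.
  have nz2 : 2%:R != 0 :> R[i] by rewrite pnatr_eq0.
  have [|S S2 HS] := mx_sqrt nz2 (@halfplane_sqrtK R) (_ : A *m B \in unitmx).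
    by rewrite unitmx_mul uA.
  have [J [P [jJ uP JP]]] := jordan_form S.
  have JS : J = P *m S *m invmx P by rewrite -JP mulmxK.
  have J2 : J *m J = P *m (A *m B) *m invmx P.
    by rewrite {2}JS !mulmxA JP -(mulmxA P S S) S2 !mulmxA.
  have [uJ _] : J \in unitmx /\ J \in unitmx.
    by apply/andP; rewrite -unitmx_mul J2 !unitmx_mul unitmx_inv uP uA uB.
  (* As J = P S P^-1, U has to be [P^-1, P]; the first component Q of V is then
     forced by A = P^-1 J Q^-1. *)
  exists (dcmx (invmx P) P), J.
  exists (dcmx (invmx A *m invmx P *m J) (invmx J *m P *m A)).
  split.
    apply/jordan_svdP; rewrite !dcmxlE !dcmxrE; split=> //.
    - by rewrite mulmxV.
    - by rewrite !mulmxA mulmxK // mulmxK // mulVmx.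
    - by rewrite Ml !mulmxA mulmxK // mulVmx // mul1mx.
    rewrite Mr -!mulmxA (mulmxA J J) J2 !mulmxA mulmxKV // mulmxKV //.
    by rewrite mulVmx // mul1mx.
  move=> a /eigenvalueP[v vJ nz_v].
  have /HS[c ->] : eigenvalue S a.
    apply/eigenvalueP; exists (v *m P).
      by rewrite -mulmxA -JP mulmxA vJ scalemxAl.
    by apply: contra_neq nz_v => vP0; rewrite -(mulmxK uP v) vP0 mul0mx.
  exact: halfplane_sqrt_in.
move=> U U' V V' J J' /jordan_svdP[jJ hU hV hA hB].
move=> /jordan_svdP[jJ' hU' hV' hA' hB'] HJ HJ'.
rewrite Ml in hA hA'; rewrite Mr in hB hB'.
apply: jordan_matrix_rank => //; apply: halfplane_sqr_rank => //.
- by move: uA; rewrite hA !unitmx_mul => /andP[/andP[]].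
- by move: uA; rewrite hA' !unitmx_mul => /andP[/andP[]].
move=> b k.
have AB : A *m B = dcmxl U *m (J *m J) *m dcmxr U.
  by rewrite hA hB !mulmxA -[_ *m _ *m dcmxl V]mulmxA hV mulmx1.
have AB' : A *m B = dcmxl U' *m (J' *m J') *m dcmxr U'.
  by rewrite hA' hB' !mulmxA -[_ *m _ *m dcmxl V']mulmxA hV' mulmx1.
by rewrite -(rank_conj_exp (J *m J) b k hU) -AB AB' rank_conj_exp.
Qed.
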